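(* Consider the noiseless, attack-free linear dynamical system $\mathbf x(t+1)=\mathbf A\mathbf x(t)$, $\mathbf y(t)=\mathbf C\mathbf x(t)$ with $\mathbf x(t)\in\mathbb R^n$ and $p$ sensors ($\mathbf y(t)\in\mathbb R^p$). If the system is $\theta$-sparse observable, then the minimum (symbol) Hamming distance between observation vectors corresponding to distinct initial states is $p-\theta+1$.
   Context: **Sparse observability.** For $\mathbf s\subseteq\{1,\ldots,p\}$, $\mathbf C_{\mathbf s}$ is the matrix formed by the rows of $\mathbf C$ indexed by $\mathbf s$. A pair $(\mathbf A,\mathbf C_{\mathbf s})$ is observable if for some positive integer $\mu$ the stacked matrix with blocks $\mathbf C_{\mathbf s},\mathbf C_{\mathbf s}\mathbf A,\ldots,\mathbf C_{\mathbf s}\mathbf A^{\mu-1}$ has full column rank. The system is $\theta$-sparse observable if $\theta$ is the smallest positive integer such that $(\mathbf A,\mathbf C_{\mathbf s})$ is observable for every $\mathbf s\subseteq\{1,\ldots,p\}$ with $|\mathbf s|=\theta$. **Observation vectors and symbols.** For an initial state $\mathbf x(0)\in\mathbb R^n$, the symbol of sensor $d\in\{1,\ldots,p\}$ is the vector of its outputs over $n$ time instants, $\mathcal Y_d=(y_d(0),y_d(1),\ldots,y_d(n-1))\in\mathbb R^n$, and the observation vector is $\mathcal Y=[\mathcal Y_1\ \mathcal Y_2\ \cdots\ \mathcal Y_p]$. **Symbol Hamming distance.** The (symbol) Hamming distance between two observation vectors $\mathcal Y^{(1)},\mathcal Y^{(2)}$ is the number of indices $d\in\{1,\ldots,p\}$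 with $\mathcal Y^{(1)}_d\ne\mathcal Y^{(2)}_d$. The minimum is over all pairs of distinct initial states $\mathbf x^{(1)}(0)\neq\mathbf x^{(2)}(0)$. *)

(* Defs.v *)
From HB Require Import structures.
From mathcomp Require Import all_boot all_order all_algebra.
From mathcomp Require Import reals.

Set Implicit Arguments.
Unset Strict Implicit.
Unset Printing Implicit Defensive.

Import GRing.Theory.
Local Open Scope ring_scope.

(* States are column vectors; sensors are the row indices ['I_p] of [C]. *)

Definition state (R : realType) (n : nat) (A : 'M[R]_n) (x0 : 'cV[R]_n)
    (t : nat) : 'cV[R]_n :=
  iter t (fun x => A *m x) x0.

Definition output (R : realType) (n p : nat) (A : 'M[R]_n) (C : 'M[R]_(p, n))
    (x0 : 'cV[R]_n) (t : nat) : 'cV[R]_p :=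
  C *m state A x0 t.

Definition sensor_rows (R : realType) (n p : nat) (C : 'M[R]_(p, n))
    (s : {set 'I_p}) : 'M[R]_(#|s|, n) :=
  rowsub (fun i : 'I_#|s| => enum_val i) C.

Definition observability_matrix (R : realType) (n q : nat) (A : 'M[R]_n)
    (C : 'M[R]_(q, n)) (mu : nat) : 'M[R]_(\sum_(k < mu) q, n) :=
  \mxcol_(k < mu) (C *m A ^+ k).

Definition observable (R : realType) (n q : nat) (A : 'M[R]_n)
    (C : 'M[R]_(q, n)) : Prop :=
  exists2 mu : nat, (0 < mu)%N & \rank (observability_matrix A C mu) = n.

Definition all_observable (R : realType) (n p : nat) (A : 'M[R]_n)
    (C : 'M[R]_(p, n)) (k : nat) : Prop :=
  forall s : {set 'I_p}, #|s| = k -> observable A (sensor_rows C s).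

(* [theta] is not required to be at most [p]: there is no set of [p + 1]
   sensors, so [theta = p + 1] exactly when the full pair [(A, C)] is not
   observable, and [theta <= p + 1] always. *)
Definition sparse_observable (R : realType) (n p : nat) (A : 'M[R]_n)
    (C : 'M[R]_(p, n)) (theta : nat) : Prop :=
  [/\ (0 < theta)%N, all_observable A C theta
    & forall k : nat, (0 < k)%N -> all_observable A C k -> (theta <= k)%N].

(* The number of time instants is the state dimension [n]. *)
Definition symbol (R : realType) (n p : nat) (A : 'M[R]_n) (C : 'M[R]_(p, n))
    (x0 : 'cV[R]_n) (d : 'I_p) : 'rV[R]_n :=
  \row_(t < n) output A C x0 t d 0.

Definition observation (R : realType) (n p : nat) (A : 'M[R]_n)
    (C : 'M[R]_(p, n)) (x0 : 'cV[R]_n) : {ffun 'I_p -> 'rV[R]_n} :=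
  [ffun d => symbol A C x0 d].

Definition hamming_distance (T : eqType) (p : nat) (Y1 Y2 : {ffun 'I_p -> T}) :
    nat :=
  #|[set d : 'I_p | Y1 d != Y2 d]|.

Definition is_min_distance (R : realType) (n p : nat) (A : 'M[R]_n)
    (C : 'M[R]_(p, n)) (m : nat) : Prop :=
  (exists x1 x2 : 'cV[R]_n, x1 <> x2 /\
     hamming_distance (observation A C x1) (observation A C x2) = m) /\
  (forall x1 x2 : 'cV[R]_n, x1 <> x2 ->
     (m <= hamming_distance (observation A C x1) (observation A C x2))%N).

(* Main.v *)
Require Import Defs.
From HB Require Import structures.
From mathcomp Require Import all_boot all_order all_algebra.
From mathcomp Require Import reals.
From mathcomp Require Import zify.

Set Implicit Arguments.
Unset Strict Implicit.
Unset Printing Implicit Defensive.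

Import GRing.Theory.
Local Open Scope ring_scope.

(** By linearity, two states produce the same symbol at a sensor exactly when
    their difference produces the zero symbol there. So the Hamming distance
    between the observations of [x] and [y] is [p] minus the size of the set of
    sensors at which [x - y] is silent, and the minimum distance is governed by
    the largest set of sensors at which some nonzero state is silent.

    A nonzero state is silent at all sensors of [s] exactly when the pair
    [(A, C_s)] is not observable. One direction needs an argument: the
    definition of observability allows any horizon [mu], whereas symbols record
    only [n] time instants. The Cayley-Hamilton theorem ([exprmx_lin_comb])
    makes the horizon [n] as good as any other ([observable_horizon]).

    If [(A, C)] is [theta]-sparse observable, then two distinct states cannot
    agree at [theta] sensors ([observable_agreement]), so the distance is at
    least [p - (theta - 1)]. By minimality of [theta], some set of [theta - 1]
    sensors does not observe the system ([sparse_observable_critical_set]);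
    a nonzero state silent there ([unobservable_agreement]), compared with the
    zero state, reaches this bound. *)

(** The remainder of ['X^k] modulo the characteristic polynomial has degree less
    than [n] and, by Cayley-Hamilton, takes the same value at [A]. *)
Lemma exprmx_lin_comb (F : fieldType) (n : nat) (A : 'M[F]_n) (k : nat) :
  exists c : nat -> F, A ^+ k = \sum_(i < n) c i *: A ^+ i.
Proof.
(* Evaluation of polynomials at [A] needs a ring with [1 != 0]. *)
case: n A => [|n] A.
  by exists (fun=> 0); apply/matrixP => -[].
pose r := 'X^k %% char_poly A.
exists (fun i => r`_i).
have r_small : (size r <= n.+1)%N.
  by rewrite -ltnS -(size_char_poly A) ltn_modp monic_neq0 ?char_poly_monic.
have -> : A ^+ k = horner_mx A r.
  rewrite -{1}(horner_mx_X A) -rmorphXn {1}(divp_eq 'X^k (char_poly A)).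
  by rewrite rmorphD rmorphM /= Cayley_Hamilton mulr0 add0r.
(* The sum over the coefficients of [r] is padded with zero terms up to [n]. *)
rewrite -{1}(coefK r) poly_def rmorph_sum /=.
rewrite -(big_mkord predT (fun i => horner_mx A (r`_i *: 'X^i))).
rewrite (big_nat_widen _ _ _ _ _ r_small).
rewrite big_mkcond -(big_mkord predT (fun i => r`_i *: A ^+ i)) /=.
apply: eq_bigr => i _; case: ltnP => [_ | le_r].
  by rewrite linearZ /= rmorphXn /= horner_mx_X.
by rewrite nth_default // scale0r.
Qed.

Lemma full_col_rank_inj (F : fieldType) (m n : nat) (M : 'M[F]_(m, n))
    (x : 'cV[F]_n) :
  \rank M = n -> M *m x = 0 -> x = 0.
Proof.
move=> rankM Mx0; apply: trmx_inj; rewrite trmx0; apply/eqP.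
have freeMT : row_free M^T by rewrite /row_free mxrank_tr rankM.
by rewrite -(mulmx_free_eq0 _ freeMT) -trmx_mul Mx0 trmx0.
Qed.

Lemma col_kernel_neq0 (F : fieldType) (m n : nat) (M : 'M[F]_(m, n)) :
  \rank M != n -> exists2 x : 'cV[F]_n, x != 0 & M *m x = 0.
Proof.
rewrite -mxrank_tr -/(row_free _) -kermx_eq0 => /rowV0Pn[v /sub_kermxP vMT0 v0].
exists v^T; first by rewrite -(inj_eq trmx_inj) trmxK trmx0.
by apply: trmx_inj; rewrite trmx_mul trmxK vMT0 trmx0.
Qed.

Section Observability.

Variables (R : realType) (n : nat) (A : 'M[R]_n).

Lemma observability_matrix_ker (q : nat) (C : 'M[R]_(q, n)) (mu : nat)
    (x : 'cV[R]_n) :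
  observability_matrix A C mu *m x = 0 <->
  forall k, (k < mu)%N -> C *m (A ^+ k *m x) = 0.
Proof.
rewrite /observability_matrix mxcol_mul -(mxcol0 (V := R) (p_ := fun=> q)).
split=> [/eq_mxcolP Cx0 k lt_k | Cx0].
  by rewrite mulmxA (Cx0 (Ordinal lt_k)).
by apply: eq_mxcol => k; rewrite -mulmxA Cx0.
Qed.

(** An output that vanishes during the first [n] instants vanishes for ever,
    since every power of [A] is a combination of the first [n] ones; so
    a state that is detected over some horizon [mu] is detected over [n]. *)
Lemma observable_horizon (q : nat) (C : 'M[R]_(q, n)) (x : 'cV[R]_n) :
  observable A C -> observability_matrix A C n *m x = 0 -> x = 0.
Proof.
case=> mu _ rank_mu /observability_matrix_ker Cx0.
apply: (full_col_rank_inj rank_mu); apply/observability_matrix_ker => k _.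
have [c ->] := exprmx_lin_comb A k.
rewrite mulmx_suml mulmx_sumr big1 // => i _.
by rewrite -scalemxAl -scalemxAr Cx0 ?scaler0.
Qed.

Lemma stateE (x : 'cV[R]_n) (t : nat) : state A x t = A ^+ t *m x.
Proof.
elim: t => [|t IHt] /=; first by rewrite expr0 mul1mx.
by rewrite -/(state A x t) IHt mulmxA exprS.
Qed.

Variables (p : nat) (C : 'M[R]_(p, n)).

Lemma symbolE (x : 'cV[R]_n) (d : 'I_p) (t : 'I_n) :
  symbol A C x d 0 t = (C *m (A ^+ t *m x)) d 0.
Proof. by rewrite -stateE /symbol [LHS]mxE. Qed.

Lemma symbolB (x y : 'cV[R]_n) (d : 'I_p) :
  symbol A C (x - y) d = symbol A C x d - symbol A C y d.
Proof.
have entryB k l (M N : 'M[R]_(k, l)) i j : (M - N) i j = M i j - N i j.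
  by rewrite !mxE.
by apply/rowP => t; rewrite entryB !symbolE !mulmxBr entryB.
Qed.

Lemma sensor_rows_ker (s : {set 'I_p}) (x : 'cV[R]_n) :
  observability_matrix A (sensor_rows C s) n *m x = 0 <->
  {in s, forall d, symbol A C x d = 0}.
Proof.
have row_s i k : (sensor_rows C s *m (A ^+ k *m x)) i 0 =
    (C *m (A ^+ k *m x)) (enum_val i) 0.
  by rewrite mul_rowsub_mx [LHS]mxE.
split=> [/observability_matrix_ker Cs0 d ds | Cs0].
  apply/rowP => t; rewrite symbolE [RHS]mxE -(enum_rankK_in ds ds) -row_s.
  by rewrite Cs0 // mxE.
apply/observability_matrix_ker => k lt_k; apply/colP => i.
by rewrite row_s -(symbolE _ _ (Ordinal lt_k)) Cs0 ?enum_valP // !mxE.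
Qed.

Definition agreement (x y : 'cV[R]_n) : {set 'I_p} :=
  [set d | symbol A C x d == symbol A C y d].

Lemma hamming_distanceE (x y : 'cV[R]_n) :
  hamming_distance (observation A C x) (observation A C y)
    = (p - #|agreement x y|)%N.
Proof.
rewrite -[X in (X - _)%N]card_ord -(cardsC (agreement x y)) addKn.
apply: eq_card => d.
by rewrite !inE !ffunE.
Qed.

(** The difference of two states is silent at every sensor where they agree, and
    an observable system is silent only on the zero state. *)
Lemma observable_agreement (s : {set 'I_p}) (x y : 'cV[R]_n) :
  observable A (sensor_rows C s) -> s \subset agreement x y -> x = y.
Proof.
move=> obs_s /subsetP agree; apply/subr0_eq.
apply: (observable_horizon obs_s); apply/sensor_rows_ker => d /agree.
by rewrite inE symbolB => /eqP ->; rewrite subrr.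
Qed.

Lemma unobservable_agreement (s : {set 'I_p}) :
  \rank (observability_matrix A (sensor_rows C s) n) != n ->
  exists2 x : 'cV[R]_n, x <> 0 & s \subset agreement x 0.
Proof.
case/col_kernel_neq0 => x x0 /sensor_rows_ker sx0.
exists x; first exact/eqP.
apply/subsetP => d /sx0 xd0.
by rewrite inE -subr_eq0 -symbolB subr0 xd0.
Qed.

(** For [theta > 1] this is the minimality of [theta]. That says nothing about
    sets of size zero, so for [theta = 1] the argument is different: the
    observability matrix of the empty set of sensors has no rows, hence rank
    zero, while [n] is positive. The rank is taken at the horizon [n], which
    makes the search for the set a decidable one. *)
Lemma sparse_observable_critical_set (theta : nat) :
  (0 < n)%N -> sparse_observable A C theta ->
  exists2 s : {set 'I_p}, #|s| = theta.-1
    & \rank (observability_matrix A (sensor_rows C s) n) != n.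
Proof.
move=> n_gt0 [theta_gt0 _ theta_min].
pose full s := \rank (observability_matrix A (sensor_rows C s) n) == n.
case: (pickP [pred s : {set 'I_p} | (#|s| == theta.-1) && ~~ full s]) => /=.
  by move=> s /andP[/eqP]; exists s.
move=> all_full; case: theta theta_gt0 theta_min all_full => // -[|k] _.
  move=> _ /(_ set0) /=; rewrite cards0 /= => /negbFE/eqP rank0.
  have := rank_leq_row
    (observability_matrix A (sensor_rows C (set0 : {set 'I_p})) n).
  by rewrite rank0 sum_nat_const cards0 muln0 leqNgt n_gt0.
move/(_ k.+1 isT) => theta_min all_full; suff /theta_min: all_observable A C k.+1.
  by rewrite ltnn.
move=> s s_k; exists n => //.
by have /= := all_full s; move/eqP: s_k => -> /negbFE/eqP.
Qed.

End Observability.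

Theorem lemma1 (R : realType) (n p : nat) (hn : (0 < n)%N)
    (A : 'M[R]_n) (C : 'M[R]_(p, n)) (theta : nat)
    (hobs : sparse_observable A C theta) :
  is_min_distance A C (p + 1 - theta)%N.
Proof.
have [s s_card s_rank] := sparse_observable_critical_set hn hobs.
have [x x_neq0 s_agree] := unobservable_agreement s_rank.
have [theta_gt0 theta_obs _] := hobs.
have lower x1 x2 : x1 <> x2 -> (#|agreement A C x1 x2| < theta)%N.
  move=> x12; rewrite ltnNge; apply/negP => le_theta.
  (* A set with at least [theta] elements has a subset with exactly [theta]. *)
  have : (0 < 'C(#|agreement A C x1 x2|, theta))%N by rewrite bin_gt0.
  rewrite -cards_draws => /card_gt0P[s'].
  rewrite inE => /andP[s'_sub /eqP s'_card].
  by apply: x12; apply: observable_agreement s'_sub; apply: theta_obs.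
split=> [|x1 x2 x12]; rewrite ?hamming_distanceE.
  (* The agreement set contains [s], so it has at least [theta - 1] elements,
     and since [x] is nonzero it has fewer than [theta]. *)
  exists x, 0; split=> //; rewrite hamming_distanceE.
  have := subset_leq_card s_agree; have := lower _ _ x_neq0.
  rewrite s_card; lia.
have := lower _ _ x12; lia.
Qed.
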